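(* Let $\mathbb{K}$ be an algebraically closed field of characteristic $0$ and let $P,Q$ be irreducible forms in $S=\mathbb{K}[x_1,\ldots,x_s,y_1,\ldots,y_n]$. Suppose that $Q\in\mathbb{K}[x_1,\ldots,x_s]$ and that $P$ is irreducible in $S/(x_1,\ldots,x_s)$. Then the ideal $(P,Q)$ is prime.
   Context: A form is a homogeneous polynomial. ''$P$ is irreducible in $S/(x_1,\ldots,x_s)$'' means that the image of $P$ in this quotient ring is irreducible. *)

(* Defs.v *)
From HB Require Import structures.
From mathcomp Require Import all_boot all_order all_algebra.
From mathcomp Require Import ring_quotient boolp.
From mathcomp Require Import mpoly.

Set Implicit Arguments.
Unset Strict Implicit.
Unset Printing Implicit Defensive.

Import GRing.Theory.

Local Open Scope ring_scope.
Local Open Scope quotient_scope.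

Section Ideals.
Variable R : comNzRingType.

Definition in_ideal_gen (g : seq R) (a : R) : Prop :=
  exists c : 'I_(size g) -> R, a = \sum_(i < size g) c i * g`_i.

(* MathComp's ideal predicates are boolean, hence the [asbool]. *)
Definition ideal_gen (g : seq R) : {pred R} := fun a => `[< in_ideal_gen g a >].

(* [idealr_closed] contains [1 \notin I]: a prime ideal is proper. *)
Definition is_prime_ideal (I : {pred R}) : Prop :=
  idealr_closed I /\ prime_idealr_closed I.

(* Invertibility is spelled out because quotient rings [{ideal_quot I}] carry
   no [unitRingType] instance for non-prime [I]. *)
Definition invertible (a : R) : Prop := exists b, a * b = 1.

Definition irreducible_elt (a : R) : Prop :=
  [/\ a <> 0, ~ invertible a
    & forall b c, a = b * c -> invertible b \/ invertible c].

Lemma ideal_gen_closed (g : seq R) :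
  1 \notin ideal_gen g -> idealr_closed (ideal_gen g).
Proof.
move=> g1; split=> //.
  apply/asboolP; exists (fun=> 0).
  by rewrite big1 // => i _; rewrite mul0r.
move=> a u v /asboolP [c ->] /asboolP [d ->]; apply/asboolP.
exists (fun i => a * c i + d i).
rewrite mulr_sumr -big_split /=; apply: eq_bigr => i _.
by rewrite mulrDl mulrA.
Qed.

End Ideals.

Section Variables.
Variables (K : fieldType) (s n : nat).

(* In [{mpoly K[s + n]}] the first [s] variables are x_1, ..., x_s and the last
   [n] are y_1, ..., y_n. *)
Definition xvar (i : 'I_s) : {mpoly K[s + n]} := 'X_(lshift n i).

Definition xvars : s.-tuple {mpoly K[s + n]} := [tuple xvar i | i < s].

Lemma xideal_proper : 1 \notin ideal_gen xvars.
Proof.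
apply/negP => /asboolP [c /(congr1 (meval (fun=> 0)))].
rewrite meval1 raddf_sum big1 => [/eqP|i _]; first by rewrite oner_eq0.
have i_s : (i < s)%N by rewrite -[X in (_ < X)%N](size_tuple xvars).
have -> : xvars`_i = xvar (Ordinal i_s).
  by rewrite -[RHS](tnth_mktuple xvar) (tnth_nth 0).
by rewrite /= mevalM mevalXU mulr0.
Qed.

Definition xideal : {pred {mpoly K[s + n]}} := ideal_gen xvars.

HB.instance Definition _ :=
  isIdealr.Build {mpoly K[s + n]} xideal (ideal_gen_closed xideal_proper).

Definition xquot : comNzRingType := {ideal_quot xideal}.

Definition to_xquot (p : {mpoly K[s + n]}) : xquot := \pi_{ideal_quot xideal} p.

Definition in_x_subring (p : {mpoly K[s + n]}) : Prop :=
  exists q : {mpoly K[s]}, p = q \mPo xvars.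

End Variables.

(* Main.v *)
Require Import Defs.
From HB Require Import structures.
From mathcomp Require Import all_boot all_order all_algebra.
From mathcomp Require Import ring_quotient boolp mpoly.
From mathcomp Require Import ring.

(* Write S = R[y] with R = K[x].  As P is homogeneous and does not vanish mod
   (x), its leading coefficient in y is a nonzero constant, so if F and G lie
   outside (P, Q) they can be reduced modulo (P, Q) until neither leading
   coefficient is divisible by Q and neither leading monomial is divisible by
   that of P.  Since Q is prime, it has a zero z at which both leading
   coefficients are nonzero.  The top-degree form in y of P(z, y) is
   P(0, y) = P mod (x), hence P(z, y) is irreducible and therefore prime in
   K[y]; comparing leading monomials it divides neither F(z, y) nor G(z, y), so
   FG is not in (P, Q).  The zero z comes from a Nullstellensatz for
   hypersurfaces, proved together with Gauss's lemma by induction on the number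
   of variables. *)

Set Implicit Arguments.
Unset Strict Implicit.
Unset Printing Implicit Defensive.

Import Order.TTheory GRing.Theory.

Local Open Scope ring_scope.

(** * Factorial rings and Gauss's lemma *)


Section PrimeElements.
Variable R : comNzRingType.
Implicit Types a b p : R.

Definition dvd_elt a b : Prop := exists c, b = a * c.

Definition prime_elt p : Prop :=
  [/\ p <> 0, ~ invertible p
    & forall a b, dvd_elt p (a * b) -> dvd_elt p a \/ dvd_elt p b].

(** The factors are asked to be prime, not merely irreducible; in a domain this already forces
    uniqueness, so existence suffices. *)
Definition factorial_ring : Prop :=
  forall a, a <> 0 -> exists u (s : seq R),
    [/\ invertible u, (forall p, p \in s -> prime_elt p)
      & a = u * \prod_(p <- s) p].

Lemma invertible_dvdl a b : invertible (a * b) -> invertible a.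
Proof. by case=> c abc; exists (b * c); rewrite mulrA. Qed.

Lemma dvd_elt_mulr a b c : dvd_elt a b -> dvd_elt a (b * c).
Proof. by case=> d ->; exists (d * c); rewrite mulrA. Qed.

Lemma prime_elt_assoc u p : invertible u -> prime_elt p -> prime_elt (u * p).
Proof.
move=> [v uv] [p0 pu pP]; split.
- by move=> up0; apply: p0; rewrite -[p]mul1r -uv mulrAC up0 mul0r.
- by rewrite mulrC => /invertible_dvdl.
have dvd_up a : dvd_elt p a -> dvd_elt (u * p) a.
  by case=> c ->; exists (v * c); rewrite mulrACA uv mul1r.
move=> a b [c abE]; case: (pP a b); last 2 first.
- by move/dvd_up; left.
- by move/dvd_up; right.
by exists (u * c); rewrite abE -mulrA mulrCA.
Qed.

(** Some prime [p] splits off from [a]; it is not a unit, so the cofactor is one and [a] is an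
    associate of [p]. *)
Lemma irreducible_prime a : factorial_ring -> irreducible_elt a -> prime_elt a.
Proof.
move=> fR [a0 aU aI]; have [u [s [uU sP aE]]] := fR a a0.
case: s => [|p s] in sP aE; first by case: aU; rewrite aE big_nil mulr1.
have pP := sP p (mem_head _ _); rewrite big_cons mulrCA in aE.
case: (aI _ _ aE) => [pU|wU]; first by case: pP.
by rewrite aE mulrC; apply: prime_elt_assoc.
Qed.

End PrimeElements.

Section Transport.
Variables (R S : comNzRingType) (f : {rmorphism R -> S}).

Lemma invertible_rmorph a : invertible a -> invertible (f a).
Proof. by case=> b ab; exists (f b); rewrite -rmorphM ab rmorph1. Qed.

Lemma dvd_elt_rmorph a b : dvd_elt a b -> dvd_elt (f a) (f b).
Proof. by case=> c ->; exists (f c); rewrite rmorphM. Qed.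

End Transport.

Section TransportRetract.
Variables (R S : comNzRingType) (f : {rmorphism R -> S}) (g : {rmorphism S -> R}).
Hypothesis fK : cancel f g.

(** Only a left inverse is asked for, so inclusions of coefficient rings, retracted by evaluation at
    0, are covered as well as isomorphisms. *)
Lemma irreducible_retract a : irreducible_elt (f a) -> irreducible_elt a.
Proof.
move=> [fa0 faU faI]; split.
- by move=> a0; apply: fa0; rewrite a0 rmorph0.
- by move/(invertible_rmorph f).
move=> b c abc; have := faI (f b) (f c).
rewrite -rmorphM abc => /(_ erefl) [] /(invertible_rmorph g).
  by rewrite fK; left.
by rewrite fK; right.
Qed.

Lemma prime_retract a : prime_elt (f a) -> prime_elt a.
Proof.
move=> [fa0 faU faP]; split.
- by move=> a0; apply: fa0; rewrite a0 rmorph0.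
- by move/(invertible_rmorph f).
move=> b c /(dvd_elt_rmorph f); rewrite rmorphM => /faP [] /(dvd_elt_rmorph g).
  by rewrite !fK; left.
by rewrite !fK; right.
Qed.

Lemma combination_retract a b c :
  (exists u v, c = u * a + v * b) <-> (exists u v, f c = u * f a + v * f b).
Proof.
split=> [[u [v ->]]|[u [v cE]]].
  by exists (f u), (f v); rewrite rmorphD !rmorphM.
exists (g u), (g v); have := congr1 g cE.
by rewrite fK rmorphD !rmorphM !fK.
Qed.

End TransportRetract.

Section GaussLemma.
Variable R : idomainType.
Implicit Types (c : R) (f g h : {poly R}).

Lemma dvd_polyC_coef c f : dvd_elt c%:P f <-> forall i, dvd_elt c f`_i.
Proof.
split=> [[g ->] i|cf]; first by exists g`_i; rewrite coefCM.
have [h hE] := boolp.choice cf; exists (\poly_(i < size f) h i).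
apply/polyP=> i; rewrite coefCM coef_poly; case: ltnP => [_|/leq_sizeP/(_ i)->] //.
by rewrite mulr0.
Qed.

Lemma dvd_polyC_mulX c f : dvd_elt c%:P (f * 'X) -> dvd_elt c%:P f.
Proof.
move/dvd_polyC_coef=> cf; apply/dvd_polyC_coef=> i.
by have := cf i.+1; rewrite coefMX.
Qed.

Lemma invertible_polyC f : invertible f -> exists2 c, invertible c & f = c%:P.
Proof.
case=> g fg; have : size (f * g) == 1%N by rewrite fg size_poly1.
rewrite size_mul_eq1 => /andP[/eqP f1 _].
have fE := size1_polyC (eq_leq f1); exists f`_0 => //.
by exists g`_0; have := congr1 (fun p : {poly R} => p`_0) fg; rewrite {1}fE coefCM coef1.
Qed.

(** Induction on both factors: the constant coefficient of the product is [a * b], so [c] divides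
    [a] or [b]; removing that constant term and cancelling X leaves a product with a shorter
    factor. *)
Lemma prime_polyC c : prime_elt c -> prime_elt c%:P.
Proof.
move=> [c0 cU cP]; split.
- by move/eqP; rewrite polyC_eq0 => /eqP.
- by case/invertible_polyC=> d dU /polyC_inj cd; apply: cU; rewrite cd.
elim/poly_ind=> [|f a IHf]; first by left; exists 0; rewrite mulr0.
elim/poly_ind=> [|g b IHg]; first by right; exists 0; rewrite mulr0.
have dvdD p q : dvd_elt c%:P p -> dvd_elt c%:P q -> dvd_elt c%:P (p + q).
  by move=> [x ->] [y ->]; exists (x + y); rewrite mulrDr.
have dvdC d : dvd_elt c d -> dvd_elt c%:P d%:P.
  by case=> x ->; exists x%:P; rewrite polyCM.
move=> cfg; have /cP [] : dvd_elt c (a * b).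
- have /dvd_polyC_coef/(_ 0%N) := cfg.
  by rewrite coef0M !coefD !coefMX !coefC !add0r.
- move=> /dvdC ca; have : dvd_elt c%:P (f * (g * 'X + b%:P)).
    apply: dvd_polyC_mulX; case: cfg => x xE; case: ca => y yE.
    exists (x - y * (g * 'X + b%:P)); rewrite mulrBr -xE mulrA -yE; ring.
  case/IHf=> [cf|]; [left|by right].
  by apply: dvdD => //; apply: dvd_elt_mulr.
- move=> /dvdC cb; have : dvd_elt c%:P ((f * 'X + a%:P) * g).
    apply: dvd_polyC_mulX; case: cfg => x xE; case: cb => y yE.
    exists (x - y * (f * 'X + a%:P)); rewrite mulrBr -xE mulrA -yE; ring.
  case/IHg=> [|cg]; [by left|right].
  by apply: dvdD => //; apply: dvd_elt_mulr.
Qed.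

Lemma irreducible_polyC c : irreducible_elt c%:P -> irreducible_elt c.
Proof.
apply: (irreducible_retract (f := @polyC R) (g := horner_eval 0)).
exact: (fun x => hornerC x 0).
Qed.

Hypothesis fR : factorial_ring R.

(** The prime factors of [c] stay prime in R[X], so each divides [g] or [h]; they are cancelled one
    at a time. *)
Lemma scale_eq_mul c f g h : c != 0 -> c *: f = g * h ->
  exists c1 c2 g1 h1, [/\ c1 != 0, c2 != 0, g = c1 *: g1, h = c2 *: h1 & f = g1 * h1].
Proof.
move=> c0; have [u [s [[v uv] sP cE]]] := fR (elimN eqP c0).
have u0 : u != 0 by apply/eqP=> u0; move: c0; rewrite cE u0 mul0r eqxx.
have v0 : v != 0 by apply/eqP=> v0; move: uv; rewrite v0 mulr0 => /eqP; rewrite eq_sym oner_eq0.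
rewrite {c}cE in c0 *; elim: s => [|p s IHs] in sP g h c0 *.
  rewrite big_nil mulr1 => fgh; exists u, 1, (v *: g), h.
  rewrite oner_eq0 scale1r scalerA uv scale1r; split=> //.
  by rewrite -scalerAl -fgh scalerA mulrC uv scale1r.
rewrite big_cons mulrCA -scalerA => fgh.
have [p0 _ _] := sP p (mem_head _ _); move/eqP in p0.
have [_ _ pP] := prime_polyC (sP p (mem_head _ _)).
have sP' q : q \in s -> prime_elt q by move=> qs; apply: sP; rewrite in_cons qs orbT.
have c0' : u * \prod_(q <- s) q != 0.
  by move: c0; rewrite big_cons mulrCA mulf_eq0 => /norP[].
have pI : injective ( *:%R p : {poly R} -> {poly R}).
  by move=> x y; rewrite -!mul_polyC => /mulfI; apply; rewrite polyC_eq0.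
case: (pP g h); first by rewrite -fgh -mul_polyC; eexists.
- case=> g' gE; move: fgh; rewrite gE mul_polyC -scalerAl => /pI.
  case/(IHs sP' g' h c0') => c1 [c2 [g1 [h1 [c10 c20 -> -> ->]]]].
  by exists (p * c1), c2, g1, h1; rewrite scalerA mulf_neq0.
- case=> h' hE; move: fgh; rewrite hE mul_polyC -scalerAr => /pI.
  case/(IHs sP' g h' c0') => c1 [c2 [g1 [h1 [c10 c20 -> -> ->]]]].
  by exists c1, (p * c2), g1, h1; rewrite scalerA mulf_neq0.
Qed.

Lemma invertible_size f : invertible f -> (size f <= 1)%N.
Proof. by case/invertible_polyC=> c _ ->; apply: size_polyC_leq1. Qed.

(** Cancelling [c] leaves g = f' g' with f = c1 f'; as [f] is irreducible of positive degree, [c1]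
    is a unit. *)
Lemma irreducible_dvd_scale f g c : irreducible_elt f -> (1 < size f)%N ->
  c != 0 -> dvd_elt f (c *: g) -> dvd_elt f g.
Proof.
move=> [f0 fU fI] f1 c0 [h] /(scale_eq_mul c0) [c1 [c2 [f' [g' [c10 c20 fE _ ->]]]]].
case: (fI c1%:P f'); rewrite ?mul_polyC //.
  by case=> d dE; exists (d * g'); rewrite fE -mul_polyC -[LHS]mul1r -dE; ring.
by move/invertible_size; rewrite -(size_scale _ c10) -fE leqNgt f1.
Qed.

(* An element of minimal degree in the ideal (f, g) pseudo-divides f and g, so
   by irreducibility of f it is constant. *)
Lemma irreducible_bezout f g : irreducible_elt f -> (1 < size f)%N -> ~ dvd_elt f g ->
  exists d u v, d != 0 /\ d%:P = u * f + v * g.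
Proof.
move=> fI f1 fg.
suff main N (e u v : {poly R}) : (size e <= N)%N -> e != 0 -> e = u * f + v * g ->
    exists d u v, d != 0 /\ d%:P = u * f + v * g.
  apply: (main (size f) f 1 0) => //; last by rewrite mul1r mul0r addr0.
  by rewrite -size_poly_gt0 ltnW.
elim: N e u v => [|N IH] e u v eN e0 eE; first by move: eN e0; rewrite leqn0 size_poly_eq0 => ->.
have [e1|e1] := leqP (size e) 1.
  exists e`_0, u, v; rewrite -size1_polyC // -eE; split=> //.
  by move: e0; rewrite (size1_polyC e1) polyC_eq0 coefC.
have divE (p : {poly R}) : exists (c : R) (q r : {poly R}),
    [/\ c != 0, (size r <= N)%N & c *: p = q * e + r].
  exists (lead_coef e ^+ scalp p e), (p %/ e)%R, (p %% e)%R; split.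
  - by rewrite expf_neq0 // lead_coef_eq0.
  - by rewrite -ltnS (leq_trans _ eN) // ltn_modp.
  - exact: Pdiv.Idomain.divp_eq.
have [c [q [r [c0 rN fE]]]] := divE f.
have [r0|r0] := eqVneq r 0; last first.
  apply: (IH r (c%:P - q * u) (- (q * v))) => //.
  have -> : r = c *: f - q * e by rewrite fE addrAC subrr add0r.
  by rewrite eE -mul_polyC; ring.
have [c' [q' [r' [c0' rN' gE]]]] := divE g.
have [r0'|r0'] := eqVneq r' 0; last first.
  apply: (IH r' (- (q' * u)) (c'%:P - q' * v)) => //.
  have -> : r' = c' *: g - q' * e by rewrite gE addrAC subrr add0r.
  by rewrite eE -mul_polyC; ring.
(* Both remainders vanish. Since [e] is not constant, [c *: f = q * e] makes [f] an associate of [e]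
   up to a scalar, so [f] divides [c' *: g], hence [g]. *)
case: fg; apply: (irreducible_dvd_scale fI f1 c0').
rewrite gE r0' addr0; move: fE; rewrite r0 addr0.
case/(scale_eq_mul c0)=> c1 [c2 [q1 [e1' [c10 c20 _ eE' fE]]]].
have [_ _ /(_ _ _ fE) [[w wE]|]] := fI.
  exists (w * (c2%:P * q')); rewrite fE eE' -mul_polyC.
  by rewrite -[LHS]mul1r -wE; ring.
by move/invertible_size; rewrite -(size_scale _ c20) -eE' leqNgt e1.
Qed.

(** If [f] has positive degree and does not divide [g], multiplying d = u f + v g by [h] shows that
    [f] divides d h, and the constant [d] can be cancelled. *)
Lemma gauss_lemma f : irreducible_elt f -> prime_elt f.
Proof.
move=> fI; have [f0 fU fI'] := fI.
have [f1|f1] := leqP (size f) 1.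
  rewrite (size1_polyC f1) in fI *; apply: prime_polyC.
  exact/(irreducible_prime fR)/irreducible_polyC.
split=> // g h [w gh]; case: (pselect (dvd_elt f g)) => [|fg]; [by left|right].
have [d [u [v [d0 dE]]]] := irreducible_bezout fI f1 fg.
apply: (irreducible_dvd_scale fI f1 d0); exists (u * h + v * w).
by rewrite -mul_polyC dE mulrDl -[v * g * h]mulrA gh; ring.
Qed.

End GaussLemma.

(** * Multivariate polynomials over a field *)


(** The [change] steps in later proofs present both sides of an identity as ring morphisms, so that
    it can be checked on generators. *)
Lemma mpoly_rmorph_ext (R : comNzRingType) (n : nat) (S : comNzRingType)
    (f g : {rmorphism {mpoly R[n]} -> S}) :
  (forall c, f c%:MP = g c%:MP) -> (forall i, f 'X_i = g 'X_i) -> f =1 g.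
Proof.
move=> fgC fgX p; rewrite (mpolyE p) !rmorph_sum; apply: eq_bigr => m _.
rewrite -mul_mpolyC !rmorphM fgC mpolyXE_id !rmorph_prod; congr (_ * _).
by apply: eq_bigr => i _; rewrite !rmorphXn fgX.
Qed.

Section Unilateral.
Variables (R : comNzRingType) (n : nat).

Definition unmuni : {poly {mpoly R[n]}} -> {mpoly R[n.+1]} :=
  horner_eval 'X_ord_max \o map_poly (@mwiden n R).

HB.instance Definition _ := GRing.RMorphism.on unmuni.

Lemma unmuniC p : unmuni p%:P = mwiden p.
Proof. by rewrite /unmuni /= /horner_eval map_polyC hornerC. Qed.

Lemma unmuniX : unmuni 'X = 'X_ord_max.
Proof. by rewrite /unmuni /= /horner_eval map_polyX hornerX. Qed.

Lemma muniX m : muni 'X_[R, m] =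
  'X_[[multinom m (widen_ord (leqnSn n) i) | i < n]] *: 'X^(m ord_max).
Proof. by rewrite muniE msuppX big_seq1 mcoeffX eqxx scale1r. Qed.

Lemma muni_widen (i : 'I_n) : muni 'X_(widen_ord (leqnSn n) i) = ('X_i : {mpoly R[n]})%:P.
Proof.
rewrite muniX mnmE -val_eqE /= ltn_eqF // expr0 alg_polyC; congr ('X_[_])%:P.
by apply/mnmP=> j; rewrite !mnmE -!val_eqE.
Qed.

Lemma muni_max : muni 'X_ord_max = 'X :> {poly {mpoly R[n]}}.
Proof.
rewrite muniX mnmE eqxx expr1 (_ : [multinom _ | _ < _] = 0%MM) ?mpolyX0 ?scale1r //.
by apply/mnmP=> j; rewrite !mnmE -val_eqE /= gtn_eqF.
Qed.

Lemma ord_max_or_widen (i : 'I_n.+1) :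
  i = ord_max \/ exists j : 'I_n, i = widen_ord (leqnSn n) j.
Proof.
case: (unliftP ord_max i) => [j ->|->]; [right|by left].
by exists j; exact/val_inj/lift_max.
Qed.

Lemma muniK : cancel (@muni n R) unmuni.
Proof.
move=> p; change ((unmuni \o @muni n R) p = idfun p).
apply: mpoly_rmorph_ext => [c|i] /=; first by rewrite muniC unmuniC mwidenC.
have [->|[j ->]] := ord_max_or_widen i; first by rewrite muni_max unmuniX.
by rewrite muni_widen unmuniC mwidenX mnmwiden1.
Qed.

Lemma muni_mwiden (p : {mpoly R[n]}) : muni (mwiden p) = p%:P.
Proof.
change ((@muni n R \o @mwiden n R) p = polyC p).
apply: mpoly_rmorph_ext => [c|i] /=; first by rewrite mwidenC muniC.
by rewrite mwidenX mnmwiden1 muni_widen.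
Qed.

Lemma unmuniK : cancel unmuni (@muni n R).
Proof.
elim/poly_ind=> [|p c IHp]; first by rewrite !rmorph0.
rewrite !(rmorphD, rmorphM) /=; by rewrite unmuniX unmuniC IHp muni_mwiden muni_max.
Qed.

Lemma irreducible_muni (p : {mpoly R[n.+1]}) :
  irreducible_elt p -> irreducible_elt (muni p).
Proof.
rewrite -{1}(muniK p).
exact: (@irreducible_retract _ _ unmuni (@muni n R) unmuniK).
Qed.

Lemma prime_of_muni (p : {mpoly R[n.+1]}) : prime_elt (muni p) -> prime_elt p.
Proof.
have muniK' : cancel (@muni n R) unmuni := muniK.
have prime_retract_muni := @prime_retract _ _ (@muni n R) unmuni muniK' p.
exact: prime_retract_muni.
Qed.

Lemma meval_muni (z : 'I_n.+1 -> R) (p : {mpoly R[n.+1]}) :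
  p.@[z] = (map_poly (meval (z \o widen_ord (leqnSn n))) (muni p)).[z ord_max].
Proof.
rewrite -[LHS]/(meval z p).
change (meval z p = (horner_eval (z ord_max) \o
  (map_poly (meval (z \o widen_ord (leqnSn n))) \o @muni n R)) p).
apply: mpoly_rmorph_ext => [c|i] /=.
  by rewrite mevalC muniC map_polyC /horner_eval hornerC /= mevalC.
have [->|[j ->]] := ord_max_or_widen i.
  by rewrite mevalXU muni_max map_polyX /horner_eval hornerX.
by rewrite mevalXU muni_widen map_polyC /horner_eval hornerC /= mevalXU.
Qed.

End Unilateral.

Definition ord_extend (T : Type) n (z : 'I_n -> T) (t : T) (i : 'I_n.+1) : T :=
  oapp z t (unlift ord_max i).

Lemma ord_extend_max (T : Type) n (z : 'I_n -> T) t : ord_extend z t ord_max = t.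
Proof. by rewrite /ord_extend unlift_none. Qed.

Lemma ord_extend_widen (T : Type) n (z : 'I_n -> T) t :
  ord_extend z t \o widen_ord (leqnSn n) =1 z.
Proof.
move=> i; rewrite /ord_extend /=.
have -> : widen_ord (leqnSn n) i = lift ord_max i by exact/val_inj/esym/lift_max.
by rewrite liftK.
Qed.

Lemma meval_ord_extend (R : comNzRingType) n (z : 'I_n -> R) t (p : {mpoly R[n.+1]}) :
  p.@[ord_extend z t] = (map_poly (meval z) (muni p)).[t].
Proof.
rewrite meval_muni ord_extend_max; congr (_.[t]).
by apply: eq_map_poly => q; apply: meval_eq; apply: ord_extend_widen.
Qed.

Lemma horner_map_bezout (A B : comNzRingType) (f : {rmorphism A -> B}) (p q u v : {poly A}) d t :
    d%:P = u * p + v * q -> (map_poly f p).[t] = 0 -> (map_poly f q).[t] = 0 -> f d = 0.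
Proof.
move=> dE pt qt; have -> : f d = (map_poly f d%:P).[t] by rewrite map_polyC hornerC.
by rewrite dE rmorphD !rmorphM hornerD !hornerM pt qt !mulr0 addr0.
Qed.

Section FactorialMPoly.
Variable K : fieldType.

Lemma invertible_mpolyC n (c : K) : c != 0 -> invertible (c%:MP : {mpoly K[n]}).
Proof. by move=> c0; exists (c^-1)%:MP; rewrite -mpolyCM divff. Qed.

(** Degrees add in products, so a divisor of 1 has degree 0; [msize] is the total degree plus one,
    and 0 at the zero polynomial. *)
Lemma invertible_mpoly n (p : {mpoly K[n]}) : invertible p <-> msize p = 1%N.
Proof.
split=> [[q pq]|/eqP/msize_poly1P[c c0 ->]]; last exact: invertible_mpolyC.
have pq0 : p * q != 0 by rewrite pq oner_eq0.
have p0 : p != 0 by apply: contraNneq pq0 => ->; rewrite mul0r.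
have q0 : q != 0 by apply: contraNneq pq0 => ->; rewrite mulr0.
have := congr1 (fun r : {mpoly K[n]} => msize r) pq.
rewrite msizeM // msize1 (mpolySpred _ p0) (mpolySpred _ q0).
by rewrite addSn addnS /= => -[/eqP]; rewrite addn_eq0 => /andP[/eqP->].
Qed.

(** Induction on the degree: in a factorization into two non-units both factors have positive, hence
    smaller, degree. *)
Lemma factorial_of_irreducible_prime n :
  (forall p : {mpoly K[n]}, irreducible_elt p -> prime_elt p) ->
  factorial_ring {mpoly K[n]}.
Proof.
move=> irr_prime p; move: {2}(msize p) (leqnn (msize p)) => N.
elim: N p => [|N IHN] p; first by rewrite leqn0 msize_poly_eq0 => /eqP->.
move=> pN p0; have [pU|pU] := pselect (invertible p).
  by exists p, [::]; rewrite big_nil mulr1.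
have [pI|pI] := pselect (irreducible_elt p).
  exists 1, [:: p]; rewrite big_seq1 mul1r; split=> //; first by exists 1; rewrite mulr1.
  by move=> q; rewrite inE => /eqP ->; apply: irr_prime.
have [a [b [pE aU bU]]] : exists a b, [/\ p = a * b, ~ invertible a & ~ invertible b].
  apply: contrapT => H; apply: pI; split=> // a b pE.
  have [aU|aU] := pselect (invertible a); [by left|right].
  by apply: contrapT => bU; apply: H; exists a, b.
have a0 : a <> 0 by move=> a0; apply: p0; rewrite pE a0 mul0r.
have b0 : b <> 0 by move=> b0; apply: p0; rewrite pE b0 mulr0.
move: aU bU; rewrite !invertible_mpoly => aU bU.
move: pN; rewrite pE msizeM; try exact/eqP.
move=> pN; have [aN bN] : (msize a <= N)%N /\ (msize b <= N)%N.
  move: pN aU bU; rewrite (mpolySpred _ (introN eqP a0)) (mpolySpred _ (introN eqP b0)).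
  case: (msize a).-1 => [//|k]; case: (msize b).-1 => [//|l] pN _ _.
  move: pN; rewrite addSn /= addSn ltnS => pN; split; apply: leq_trans pN.
    by rewrite -!addSnnS leq_addr.
  exact: leq_addl.
have [u [s [[u' uU] sP aE]]] := IHN a aN a0.
have [v [t [[v' vU] tP bE]]] := IHN b bN b0.
exists (u * v), (s ++ t); split; last by rewrite big_cat aE bE mulrACA.
  by exists (u' * v'); rewrite mulrACA uU vU mulr1.
by move=> q; rewrite mem_cat => /orP[/sP|/tP].
Qed.

(** Without variables every nonzero element is a unit; otherwise Gauss's lemma applies over the
    polynomials in one variable fewer, factorial by induction. *)
Lemma irreducible_prime_mpoly n (p : {mpoly K[n]}) : irreducible_elt p -> prime_elt p.
Proof.
elim: n p => [|n IHn] p pI.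
  have [p0 pU _] := pI; case: pU; apply/invertible_mpoly/eqP/msize_poly1P.
  exists p@_0; last exact: esym (mpolyKC p).
  by apply: contra_notN p0 => /eqP p0; rewrite -(mpolyKC p) p0 mpolyC0.
apply/prime_of_muni/gauss_lemma/irreducible_muni => //.
exact: factorial_of_irreducible_prime.
Qed.

Lemma factorial_mpoly n : factorial_ring {mpoly K[n]}.
Proof. by apply/factorial_of_irreducible_prime/irreducible_prime_mpoly. Qed.

End FactorialMPoly.

(** * Zeros over an algebraically closed field *)

Section Zeros.
Variable K : closedFieldType.

(** A point where the leading coefficient in the last variable does not vanish leaves a nonzero
    univariate polynomial, which has a non-root. *)
Lemma mpoly_nonzero_point n (p : {mpoly K[n]}) : p != 0 -> exists z, p.@[z] != 0.
Proof.
elim: n p => [|n IHn] p p0.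
  exists (fun=> 0); rewrite -(mpolyKC p) mevalC.
  by apply: contraNneq p0 => p0; rewrite -(mpolyKC p) p0 mpolyC0.
have mp0 : muni p != 0.
  by apply: contraNneq p0 => mp0; rewrite -(muniK p) mp0 rmorph0.
have [|z z0] := IHn (lead_coef (muni p)); first by rewrite lead_coef_eq0.
have /closed_nonrootP[t t0] : map_poly (meval z) (muni p) != 0.
  by apply: contraNneq z0 => q0; rewrite lead_coefE -coef_map q0 coef0.
by exists (ord_extend z t); rewrite meval_ord_extend.
Qed.

(* When [p] involves the last variable, an identity [d = u p + v q] with [d]
   free of that variable reduces the claim to [d] and the leading coefficient. *)
Lemma hypersurface_nullstellensatz n (p q : {mpoly K[n]}) :
  irreducible_elt p -> ~ dvd_elt p q -> exists2 z, p.@[z] = 0 & q.@[z] != 0.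
Proof.
elim: n p q => [|n IHn] p q pI pq.
  have [p0 pU _] := pI; case: pU; apply/invertible_mpoly/eqP/msize_poly1P.
  exists p@_0; last exact: esym (mpolyKC p).
  by apply: contra_notN p0 => /eqP p0; rewrite -(mpolyKC p) p0 mpolyC0.
have mpI := irreducible_muni pI.
have mpq : ~ dvd_elt (muni p) (muni q).
  case=> c qE; apply: pq; exists (unmuni c).
  by apply: (can_inj (@muniK K n)); rewrite muniM unmuniK.
(* If [p] is free of the last variable, it fails to divide some coefficient of [q]; at a zero of [p]
   where that coefficient survives, any last coordinate that is not a root of [q] works. *)
have [p1|p1] := leqP (size (muni p)) 1.
  have pE := size1_polyC p1; set c := (muni p)`_0 in pE.
  have [i ci] : exists i, ~ dvd_elt c (muni q)`_i.
    by apply: contrapT => H; apply: mpq; rewrite pE; apply/dvd_polyC_coef => i;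
      apply: contrapT => ci; apply: H; exists i.
  have cI : irreducible_elt c by apply: irreducible_polyC; rewrite -pE.
  have [z cz qz] := IHn c _ cI ci.
  have /closed_nonrootP[t t0] : map_poly (meval z) (muni q) != 0.
    by apply: contraNneq qz => q0; rewrite -coef_map q0 coef0.
  by exists (ord_extend z t); rewrite meval_ord_extend // pE map_polyC hornerC.
have [d [u [v [d0 dE]]]] : exists (d : {mpoly K[n]}) (u v : {poly {mpoly K[n]}}),
    d != 0 /\ d%:P = u * muni p + v * muni q.
  exact: (irreducible_bezout (@factorial_mpoly _ n) mpI p1 mpq).
have p0 : lead_coef (muni p) != 0.
  by rewrite lead_coef_eq0 -size_poly_gt0 ltnW.
(* The leading coefficient of [p] survives at [z], so [p] stays nonconstant in the last variable and
   has a root [t]; as [d] survives too, [q] cannot vanish there. *)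
have [z] := mpoly_nonzero_point (mulf_neq0 d0 p0).
rewrite mevalM mulf_eq0 => /norP[dz pz].
have /closed_rootP[t t0] : size (map_poly (meval z) (muni p)) != 1%N.
  by rewrite size_map_poly_id0 // gtn_eqF.
exists (ord_extend z t); rewrite meval_ord_extend; first exact/rootP.
apply: contraNneq dz => qt; apply/eqP.
exact: (horner_map_bezout (f := meval z) dE (rootP t0) qt).
Qed.

End Zeros.

(** * Top forms and leading monomials *)


Section TopForm.
Variables (R : comNzRingType) (n : nat).
Implicit Types p q : {mpoly R[n]}.

Lemma mcoeff_pihomog d p m :
  (pihomog mdeg d p)@_m = if mdeg m == d then p@_m else 0.
Proof.
case: ifPn => [/eqP md|md]; last exact: dhomog_nemf_coeff (pihomogP _ _ _) md.
have -> : p@_m = \sum_(i < maxn (msize p) d.+1) (pihomog mdeg i p)@_m.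
  by rewrite {1}(pihomog_partitionE (leq_maxl (msize p) d.+1)) raddf_sum.
rewrite (bigD1 (Ordinal (leq_maxr (msize p) d.+1))) //= big1 ?addr0 // => i id'.
apply: dhomog_nemf_coeff (pihomogP _ _ _) _.
by rewrite /= md eq_sym; apply: contraNneq id' => id; apply/eqP/val_inj.
Qed.

(** Degrees being at most [k] and [l], only the two top components contribute in degree [k + l]. *)
Lemma pihomogM_top p q k l : (msize p <= k.+1)%N -> (msize q <= l.+1)%N ->
  pihomog mdeg (k + l) (p * q) = pihomog mdeg k p * pihomog mdeg l q.
Proof.
move=> pk ql; rewrite {1}(pihomog_partitionE pk) {1}(pihomog_partitionE ql).
have pqM i j : pihomog mdeg i p * pihomog mdeg j q \is (i + j).-homog.
  exact: dhomogM (pihomogP _ _ _) (pihomogP _ _ _).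
rewrite mulr_suml raddf_sum big_ord_recr big1 /= ?add0r => [|i _]; last first.
  rewrite mulr_sumr raddf_sum big1 // => j _; apply: pihomog_ne0 (pqM _ _).
  by rewrite ltn_eqF // -addSn leq_add // -ltnS.
rewrite mulr_sumr raddf_sum big_ord_recr big1 /= ?add0r => [|j _]; last first.
  by apply: pihomog_ne0 (pqM _ _); rewrite ltn_eqF // ltn_add2l.
exact: pihomog_dE (pqM _ _).
Qed.

Lemma dhomog0_mpolyC p : p \is 0.-homog -> p = (p@_0)%:MP.
Proof.
move=> /dhomogP hp; apply: msize1_polyC; rewrite msizeE.
by rewrite big_seq; apply/bigmax_leqP_seq=> m _ mp; rewrite hp.
Qed.

Lemma meval0_dhomog d p : p \is d.-homog -> (0 < d)%N -> p.@[fun=> 0] = 0.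
Proof.
move=> /dhomogP hp d0; rewrite mevalE big_seq big1 // => m /hp md.
have [i mi] : exists i, m i != 0%N.
  apply/existsP; rewrite -negb_forall; apply: contraL d0 => /forallP m0.
  by rewrite -md /= mdegE big1 // => i _; apply/eqP.
by rewrite (bigD1 i) //= expr0n (negbTE mi) mul0r mulr0.
Qed.

End TopForm.

Section IrreducibleTop.
Variables (K : fieldType) (n : nat).
Implicit Types p : {mpoly K[n]}.

(** The leading monomial of [p] lies in its top form, so it has degree 0 when that form is
    constant. *)
Lemma invertible_pihomog_top p : invertible (pihomog mdeg (msize p).-1 p) -> invertible p.
Proof.
have [->|p0] := eqVneq p 0; first by rewrite pihomog0.
rewrite !invertible_mpoly => p1.
have lp : mlead p \in msupp (pihomog mdeg (msize p).-1 p).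
  rewrite mcoeff_msupp mcoeff_pihomog -(mlead_deg p0) eqxx -mcoeff_msupp.
  exact: mlead_supp.
have := msize_mdeg_lt lp; rewrite p1 ltnS leqn0 => /eqP lp0.
by rewrite -(mlead_deg p0) lp0.
Qed.

(** A factorization of [p] induces one of its top form; there one factor is a unit, hence so is the
    factor of [p] it comes from. *)
Lemma irreducible_top d p : (msize p <= d.+1)%N ->
  irreducible_elt (pihomog mdeg d p) -> irreducible_elt p.
Proof.
move=> pd [t0 tU tI].
have p0 : p <> 0 by move=> p0; apply: t0; rewrite p0 pihomog0.
have dE : d = (msize p).-1.
  apply/eqP; move: pd; rewrite (mpolySpred _ (introN eqP p0)) ltnS leq_eqVlt eq_sym.
  case: eqVneq => //= _ pd; case: t0; apply/mpolyP=> m; rewrite mcoeff0 mcoeff_pihomog.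
  case: eqP => // md; apply/eqP; rewrite mcoeff_eq0.
  by apply: msize_mdeg_ge; rewrite md (mpolySpred _ (introN eqP p0)).
split=> //.
  rewrite invertible_mpoly => p1; apply: tU; rewrite dE p1.
  rewrite pihomog_dE ?invertible_mpoly //; have/eqP/msize_poly1P[c _ ->] := p1.
  by apply/dhomogP => m; rewrite msuppC; case: eqP => // _; rewrite inE => /eqP->; exact: mdeg0.
move=> b c pE.
have b0 : b != 0 by apply/eqP => b0; apply: p0; rewrite pE b0 mul0r.
have c0 : c != 0 by apply/eqP => c0; apply: p0; rewrite pE c0 mulr0.
have := tI (pihomog mdeg (msize b).-1 b) (pihomog mdeg (msize c).-1 c).
rewrite -pihomogM_top -?(mpolySpred _ b0) -?(mpolySpred _ c0) //.
have -> : ((msize b).-1 + (msize c).-1)%N = d.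
  by rewrite dE pE msizeM // (mpolySpred _ b0) (mpolySpred _ c0) addnS.
by rewrite -pE => /(_ erefl) [] /invertible_pihomog_top; [left|right].
Qed.

End IrreducibleTop.

Section LeadingMonomial.
Variables (n : nat).

Definition in_ideal2 (R : comNzRingType) (p : {mpoly R[n]}) (c : R) (f : {mpoly R[n]}) : Prop :=
  exists a b, f = a * p + b * c%:MP.

(** A coefficient map can only shrink the support, and the leading monomial stays in it. *)
Lemma mlead_map_mpoly (R S : comNzRingType) (f : {rmorphism R -> S}) (p : {mpoly R[n]}) :
  f (mleadc p) != 0 -> mlead (map_mpoly f p) = mlead p.
Proof.
move=> fp; apply/eqP; rewrite eq_le; apply/andP; split; apply: msupp_le_mlead.
  rewrite mcoeff_msupp.
  have : mlead (map_mpoly f p) \in msupp (map_mpoly f p).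
    apply: mlead_supp; apply: contraNneq fp => fp0.
    by rewrite -(mcoeff_map_mpoly f) fp0 mcoeff0.
  rewrite mcoeff_msupp mcoeff_map_mpoly; apply: contraNneq => ->.
  by rewrite raddf0.
by rewrite mcoeff_msupp mcoeff_map_mpoly.
Qed.

Lemma mlead_cancel_lt (R : comNzRingType) (p q : {mpoly R[n]}) :
  mlead q = mlead p -> mleadc q = mleadc p -> p - q != 0 -> (mlead (p - q) < mlead p)%O.
Proof.
move=> qp cqp pq0; rewrite lt_neqAle; apply/andP; split; last first.
  by have := mleadB_le p q; rewrite qp joinxx.
apply: contraNneq (pq0) => pqE; rewrite -mleadc_eq0 pqE mcoeffB -{2}qp cqp.
by rewrite subrr.
Qed.

Variable R : idomainType.
Variables (p : {mpoly R[n]}) (c : R) (u : R).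
Hypothesis pu : mleadc p * u = 1.

(** Well-founded induction on the leading monomial: a leading coefficient divisible by [c] is
    cancelled by a multiple of [c], and a leading monomial divisible by that of [p] by a multiple of
    [p]. *)
Lemma reduce_mod_ideal2 f : ~ in_ideal2 p c f -> exists g,
  [/\ in_ideal2 p c (f - g), ~ dvd_elt c (mleadc g) & ~~ (mlead p <= mlead g)%MM].
Proof.
elim/mleadrect: f => f IHf fJ.
(* An ideal element with the leading term of [f] may be subtracted; the difference is nonzero
   because [f] is outside the ideal. *)
have step h : in_ideal2 p c h -> mlead h = mlead f -> mleadc h = mleadc f -> exists g,
    [/\ in_ideal2 p c (f - g), ~ dvd_elt c (mleadc g) & ~~ (mlead p <= mlead g)%MM].
  move=> [a [b hE]] hf hcf; have [fh|fh] := eqVneq (f - h) 0.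
    by case: fJ; exists a, b; rewrite -hE; apply/eqP; rewrite -subr_eq0 fh.
  have [|g [[a' [b' gE]] gc gp]] := IHf _ (mlead_cancel_lt hf hcf fh).
    move=> [a' [b' fhE]]; apply: fJ; exists (a' + a), (b' + b).
    by rewrite -[f](subrK h) fhE hE; ring.
  exists g; split=> //; exists (a' + a), (b' + b).
  have -> : f - g = (f - h - g) + h by ring.
  by rewrite gE hE; ring.
have p0 : p != 0.
  by apply/eqP => p0; move: pu; rewrite p0 mcoeff0 mul0r => /eqP; rewrite eq_sym oner_eq0.
have f0 : f != 0.
  by apply/eqP => f0; apply: fJ; exists 0, 0; rewrite f0; ring.
have fc0 : mleadc f != 0 by rewrite mleadc_eq0.
have u0 : u != 0.
  by apply/eqP => u0; move: pu; rewrite u0 mulr0 => /eqP; rewrite eq_sym oner_eq0.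
have [[w wE]|fc] := pselect (dvd_elt c (mleadc f)).
  apply: (step (mleadc f *: 'X_[mlead f])).
  - exists 0, (w *: 'X_[mlead f]).
    by rewrite wE -!mul_mpolyC mpolyCM; ring.
  - by rewrite mleadZ // mleadXm.
  - by rewrite mleadZ // mleadXm mcoeffZ mcoeffX eqxx mulr1.
have [pf|pf] := boolP (mlead p <= mlead f)%MM; last first.
  by exists f; split=> //; exists 0, 0; ring.
have X0 : 'X_[R, mlead f - mlead p] != 0 by rewrite -mleadc_eq0 mleadXm mcoeffX eqxx oner_eq0.
have lE : mlead (p * 'X_[mlead f - mlead p]) = mlead f.
  by rewrite mleadM // mleadXm addmC submK.
(* Since [u] inverts the leading coefficient of [p], this multiple of [p] has exactly the leading
   term of [f]. *)
apply: (step ((mleadc f * u) *: (p * 'X_[mlead f - mlead p]))).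
- by exists ((mleadc f * u) *: 'X_[mlead f - mlead p]), 0; rewrite -!mul_mpolyC; ring.
- by rewrite mleadZ ?mulf_neq0.
- rewrite mleadZ ?mulf_neq0 // lE mcoeffZ -{2}(submK pf) mcoeffMX.
  by rewrite -mulrA [u * _]mulrC pu mulr1.
Qed.

End LeadingMonomial.

(** * Polynomials in x and y as polynomials in y over K[x] *)


Section Curry.
Variables (R : comNzRingType) (s n : nat).

Definition curry_mpoly : {mpoly R[s + n]} -> {mpoly {mpoly R[s]}[n]} :=
  mmap (@mpolyC n {mpoly R[s]} \o @mpolyC s R)
    (fun i => match split i with inl j => ('X_j)%:MP | inr j => 'X_j end).

HB.instance Definition _ := GRing.RMorphism.on curry_mpoly.

Definition uncurry_mpoly : {mpoly {mpoly R[s]}[n]} -> {mpoly R[s + n]} :=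
  mmap (comp_mpoly [tuple 'X_(lshift n i) | i < s]) (fun j => 'X_(rshift s j)).

HB.instance Definition _ := GRing.RMorphism.on uncurry_mpoly.

Lemma curry_mpolyC c : curry_mpoly c%:MP = c%:MP%:MP.
Proof. exact: mmapC. Qed.

Lemma curry_lshift j : curry_mpoly 'X_(lshift n j) = ('X_j)%:MP.
Proof. by rewrite /curry_mpoly mmapX mmap1U (unsplitK (inl j)). Qed.

Lemma curry_rshift j : curry_mpoly 'X_(rshift s j) = 'X_j.
Proof. by rewrite /curry_mpoly mmapX mmap1U (unsplitK (inr j)). Qed.

Lemma curry_mpolyK : cancel curry_mpoly uncurry_mpoly.
Proof.
move=> p; change ((uncurry_mpoly \o curry_mpoly) p = idfun p).
apply: mpoly_rmorph_ext => [c|i] /=.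
  by rewrite curry_mpolyC /uncurry_mpoly mmapC /= comp_mpolyC.
case: (split_ordP i) => j ->.
  by rewrite curry_lshift /uncurry_mpoly mmapC /= comp_mpolyXU -tnth_nth tnth_mktuple.
by rewrite curry_rshift /uncurry_mpoly mmapX mmap1U.
Qed.

Lemma curry_comp_lshift (q : {mpoly R[s]}) :
  curry_mpoly (q \mPo [tuple 'X_(lshift n i) | i < s]) = q%:MP.
Proof.
change ((curry_mpoly \o comp_mpoly [tuple 'X_(lshift n i) | i < s]) q = mpolyC n q).
apply: mpoly_rmorph_ext => [c|i] /=; first by rewrite comp_mpolyC curry_mpolyC.
by rewrite comp_mpolyXU -tnth_nth tnth_mktuple curry_lshift.
Qed.

Definition xmnm (m : 'X_{1..s + n}) : 'X_{1..s} := [multinom m (lshift n i) | i < s].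
Definition ymnm (m : 'X_{1..s + n}) : 'X_{1..n} := [multinom m (rshift s j) | j < n].

Lemma mdeg_xy m : mdeg m = (mdeg (xmnm m) + mdeg (ymnm m))%N.
Proof.
rewrite !mdegE big_split_ord /=.
by congr (_ + _)%N; apply: eq_bigr => i _; rewrite mnmE.
Qed.

Lemma curry_mpolyX m : curry_mpoly 'X_[m] = 'X_[xmnm m] *: 'X_[ymnm m].
Proof.
rewrite mpolyXE_id rmorph_prod big_split_ord -mul_mpolyC; congr (_ * _) => /=.
  rewrite mpolyXE_id rmorph_prod; apply: eq_bigr => i _.
  by rewrite rmorphXn /= curry_lshift mnmE rmorphXn.
rewrite mpolyXE_id; apply: eq_bigr => i _.
by rewrite rmorphXn /= curry_rshift mnmE.
Qed.

Lemma mcoeff_curry p k : (curry_mpoly p)@_k =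
  \sum_(m <- msupp p | ymnm m == k) p@_m *: 'X_[xmnm m].
Proof.
rewrite {1}(mpolyE p) rmorph_sum raddf_sum [RHS]big_mkcond /=; apply: eq_bigr => m _.
rewrite -mul_mpolyC rmorphM /= curry_mpolyC curry_mpolyX mcoeffCM mcoeffZ mcoeffX.
by rewrite mul_mpolyC; case: eqP => _; rewrite ?mulr1 ?mulr0 ?scaler0.
Qed.

(** The x-part and y-part of a monomial share its degree. The subtraction is truncated;
    [mcoeff_curry_gt] covers [mdeg k] above [d]. *)
Lemma mcoeff_curry_dhomog d p k : p \is d.-homog ->
  (curry_mpoly p)@_k \is (d - mdeg k).-homog.
Proof.
move=> /dhomogP hp; rewrite mcoeff_curry big_seq_cond rpred_sum // => m /andP[/hp /= md /eqP mk].
by rewrite dhomogZ // dhomogX /= -md mdeg_xy mk addnK.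
Qed.

Lemma mcoeff_curry_gt d p k : p \is d.-homog -> (d < mdeg k)%N -> (curry_mpoly p)@_k = 0.
Proof.
move=> /dhomogP hp dk; rewrite mcoeff_curry big_seq_cond big1 // => m /andP[/hp /= md /eqP mk].
by move: dk; rewrite -md mdeg_xy mk ltnNge leq_addl.
Qed.

Definition eval_x (z : 'I_s -> R) : {mpoly R[s + n]} -> {mpoly R[n]} :=
  map_mpoly (meval z) \o curry_mpoly.

HB.instance Definition _ z := GRing.RMorphism.on (eval_x z).

Lemma mcoeff_eval_x z p k : (eval_x z p)@_k = ((curry_mpoly p)@_k).@[z].
Proof. by rewrite mcoeff_map_mpoly. Qed.

(** A y-monomial of degree [d] has a constant coefficient, the same for all [z]; in lower degree the
    coefficient is homogeneous of positive degree and vanishes at x = 0. *)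
Lemma pihomog_eval_x d z p : p \is d.-homog ->
  pihomog mdeg d (eval_x z p) = eval_x (fun=> 0) p.
Proof.
move=> hp; apply/mpolyP => k; rewrite mcoeff_pihomog !mcoeff_eval_x.
have := mcoeff_curry_dhomog k hp.
case: ltngtP => [kd|dk|->] hk.
- by rewrite (meval0_dhomog hk) // subn_gt0.
- by rewrite (mcoeff_curry_gt hp) // meval0.
by rewrite subnn in hk; rewrite (dhomog0_mpolyC hk) !mevalC.
Qed.

Lemma msize_eval_x d z p : p \is d.-homog -> (msize (eval_x z p) <= d.+1)%N.
Proof.
move=> hp; rewrite msizeE big_seq; apply/bigmax_leqP_seq => m _.
rewrite mcoeff_msupp mcoeff_eval_x ltnS leqNgt; apply: contraNN => dm.
by rewrite (mcoeff_curry_gt hp) // meval0.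
Qed.

(** A monomial of p(0, y) has degree [d], and the order compares degrees first, so the leading
    monomial has degree at least [d] and its coefficient is homogeneous of degree 0. *)
Lemma mleadc_curry_dhomog d p : p \is d.-homog -> eval_x (fun=> 0) p != 0 ->
  exists2 c, c != 0 & mleadc (curry_mpoly p) = c%:MP.
Proof.
move=> hp p0; have cp0 : curry_mpoly p != 0.
  by apply: contraNneq p0 => cp0; rewrite /eval_x /= cp0 raddf0.
have mk : mlead (eval_x (fun=> 0) p) \in msupp (eval_x (fun=> 0) p) by exact: mlead_supp.
have dk : mdeg (mlead (eval_x (fun=> 0) p)) = d.
  move: mk; rewrite -(pihomog_eval_x (fun=> 0) hp).
  by move: (pihomogP mdeg d (eval_x (fun=> 0) p)) => /dhomogP; apply.
have lead_ge : (d <= mdeg (mlead (curry_mpoly p)))%N.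
  rewrite -dk; apply/lemc_mdeg/msupp_le_mlead; move: mk.
  by rewrite !mcoeff_msupp mcoeff_eval_x; apply: contraNneq => ->; rewrite meval0.
have := mcoeff_curry_dhomog (mlead (curry_mpoly p)) hp.
rewrite (eqP (_ : (d - _ == 0)%N)) ?subn_eq0 // => /dhomog0_mpolyC lE.
exists ((mleadc (curry_mpoly p))@_0) => //.
by move: cp0; rewrite -mleadc_eq0 lE; apply: contraNneq; rewrite mpolyCK => ->.
Qed.

Lemma in_ideal2_curry (p q f : {mpoly R[s + n]}) c : curry_mpoly q = c%:MP ->
  (exists u v, f = u * p + v * q) <-> in_ideal2 (curry_mpoly p) c (curry_mpoly f).
Proof.
move=> qc; rewrite /in_ideal2 -qc.
exact: (@combination_retract _ _ curry_mpoly uncurry_mpoly curry_mpolyK).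
Qed.

End Curry.

(** * The quotient by (x) as K[y] *)

Section XQuotient.
Variables (K : fieldType) (s n : nat).
Local Notation to_xquot := (@to_xquot K s n).
Local Notation eval0 := (@eval_x K s n (fun=> 0)).
Local Notation incl :=
  (comp_mpoly [tuple 'X_(rshift s j) | j < n] : {mpoly K[n]} -> {mpoly K[s + n]}).

Fact to_xquot_is_zmod_morphism : zmod_morphism to_xquot.
Proof. exact: (rmorphB (\pi_{ideal_quot (@xideal K s n)})%qT). Qed.

Fact to_xquot_is_monoid_morphism : monoid_morphism to_xquot.
Proof.
by split=> [|p q]; [exact: (rmorph1 (\pi_{ideal_quot (@xideal K s n)})%qT)
  |exact: (rmorphM (\pi_{ideal_quot (@xideal K s n)})%qT)].
Qed.

HB.instance Definition _ := GRing.isZmodMorphism.Build _ _ to_xquot to_xquot_is_zmod_morphism.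
HB.instance Definition _ :=
  GRing.isMonoidMorphism.Build _ _ to_xquot to_xquot_is_monoid_morphism.

Lemma xvar_nth (i : 'I_s) : (xvars K s n)`_i = 'X_(lshift n i).
Proof. by rewrite -tnth_nth tnth_mktuple. Qed.

Lemma eval_x_lshift z i : eval_x z ('X_(lshift n i) : {mpoly K[s + n]}) = (z i)%:MP.
Proof. by rewrite /eval_x /= curry_lshift map_mpolyC /= mevalXU. Qed.

Lemma eval_x_incl z p : eval_x z (incl p) = p.
Proof.
change ((@eval_x K s n z \o incl) p = idfun p).
apply: mpoly_rmorph_ext => [c|i] /=.
  by rewrite comp_mpolyC /eval_x /= curry_mpolyC map_mpolyC /= mevalC.
by rewrite comp_mpolyXU -tnth_nth tnth_mktuple /eval_x /= curry_rshift map_mpolyX.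
Qed.

Lemma to_xquot_xvar i : to_xquot 'X_(lshift n i) = 0.
Proof.
apply/eqP; rewrite -[0](rmorph0 to_xquot) /to_xquot -Quotient.idealrBE subr0.
apply/asboolP; have i_s : (i < size (xvars K s n))%N by rewrite size_tuple.
exists (fun j => (j == Ordinal i_s)%:R).
rewrite (bigD1 (Ordinal i_s)) //= eqxx mul1r xvar_nth big1 ?addr0 // => j /negbTE->.
by rewrite mul0r.
Qed.

(** With [eval_x_incl] and [eval0_xideal], this identifies S/(x) with K[y] without building the
    isomorphism. *)
Lemma to_xquot_eval0 p : to_xquot (incl (eval0 p)) = to_xquot p.
Proof.
change (((to_xquot \o incl) \o eval0) p = to_xquot p).
apply: mpoly_rmorph_ext => [c|i] /=.
  by rewrite /eval_x /= curry_mpolyC map_mpolyC /= mevalC comp_mpolyC.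
case: (split_ordP i) => j ->; first by rewrite eval_x_lshift mpolyC0 raddf0 to_xquot_xvar rmorph0.
by rewrite /eval_x /= curry_rshift map_mpolyX comp_mpolyXU -tnth_nth tnth_mktuple.
Qed.

Lemma eval0_xideal p : p \in @xideal K s n -> eval0 p = 0.
Proof.
move/asboolP=> [c ->]; rewrite rmorph_sum big1 // => i _.
have i_s : (i < s)%N by rewrite -[X in (_ < X)%N](size_tuple (xvars K s n)).
by rewrite rmorphM /= (xvar_nth (Ordinal i_s)) eval_x_lshift mpolyC0 mulr0.
Qed.

Lemma invertible_eval0 p : invertible (to_xquot p) -> invertible (eval0 p).
Proof.
(* For a lift of the inverse [b], the product with [p] differs from 1 by an element of (x), which
   [eval0] kills. *)
case=> b pb; exists (eval0 (repr b)); rewrite -rmorphM.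
apply/eqP; rewrite -subr_eq0 -(rmorph1 eval0) -rmorphB; apply/eqP/eval0_xideal.
rewrite Quotient.idealrBE -/(to_xquot _); apply/eqP.
by rewrite -[LHS]/(to_xquot (p * repr b)) rmorphM /= {2}/to_xquot reprK pb rmorph1.
Qed.

(** Including a factorization of [eval0 p] into S and reducing modulo (x) gives one of the class of
    [p]. *)
Lemma irreducible_eval0 p : irreducible_elt (to_xquot p) -> irreducible_elt (eval0 p).
Proof.
move=> [p0 pU pI]; split.
- by move=> ep0; apply: p0; rewrite -to_xquot_eval0 ep0 !raddf0.
- by move=> eU; apply: pU; rewrite -to_xquot_eval0; do 2!apply: invertible_rmorph.
move=> b c bc; have := pI (to_xquot (incl b)) (to_xquot (incl c)).
rewrite -!rmorphM /= -bc to_xquot_eval0 => /(_ erefl).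
by case=> /invertible_eval0; rewrite eval_x_incl; [left|right].
Qed.

Lemma irreducible_eval_x d z p : p \is d.-homog ->
  irreducible_elt (to_xquot p) -> irreducible_elt (eval_x z p).
Proof.
move=> hp /irreducible_eval0 pI; apply: (irreducible_top (msize_eval_x z hp)).
by rewrite pihomog_eval_x.
Qed.

End XQuotient.


(** * Primality by specialization at zeros of q *)

Section PrimeIdeal2.
Variables (K : closedFieldType) (s n : nat).
Variables (p : {mpoly {mpoly K[s]}[n]}) (q : {mpoly K[s]}).
Hypothesis pC : exists2 c : K, c != 0 & mleadc p = c%:MP.
Hypothesis pI : forall z : 'I_s -> K, irreducible_elt (map_mpoly (meval z) p).
Hypothesis qI : irreducible_elt q.

Lemma map_meval_ideal2 (z : 'I_s -> K) f : q.@[z] = 0 -> in_ideal2 p q f ->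
  dvd_elt (map_mpoly (meval z) p) (map_mpoly (meval z) f).
Proof.
move=> qz [a [b ->]]; exists (map_mpoly (meval z) a).
rewrite rmorphD /= !(rmorphM (map_mpoly (meval z))) /=.
by rewrite map_mpolyC /= qz mpolyC0 mulr0 addr0 mulrC.
Qed.

Lemma ideal2_proper : ~ in_ideal2 p q 1.
Proof.
have [_ qU _] := qI.
(* Applied to 1, which the non-unit [q] does not divide, the Nullstellensatz merely provides a zero
   of [q]. *)
have [z qz _] : exists2 z, q.@[z] = 0 & (1 : {mpoly K[s]}).@[z] != 0.
  by apply: hypersurface_nullstellensatz => // -[c qc]; apply: qU; exists c.
move/(map_meval_ideal2 qz) => [c pc]; have [_ pU _] := pI z; apply: pU.
by exists c; rewrite -pc rmorph1.
Qed.

Lemma ideal2_prime f g : in_ideal2 p q (f * g) -> in_ideal2 p q f \/ in_ideal2 p q g.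
Proof.
move=> fgJ; have [c c0 pc] := pC.
have pu : mleadc p * (c^-1)%:MP = 1 by rewrite pc -mpolyCM divff.
apply: contrapT => /not_orP[fJ gJ].
have [f1 [[a [b fE]] f1q f1p]] := reduce_mod_ideal2 pu fJ.
have [g1 [[a' [b' gE]] g1q g1p]] := reduce_mod_ideal2 pu gJ.
have f1g1 : in_ideal2 p q (f1 * g1).
  have [a2 [b2 fgE]] := fgJ.
  exists (a2 - a * g1 - f * a'), (b2 - b * g1 - f * b').
  have -> : f1 * g1 = f * g - (f - f1) * g1 - f * (g - g1) by ring.
  by rewrite fgE fE gE; ring.
have [_ _ qP] := irreducible_prime_mpoly qI.
(* The prime [q] divides neither leading coefficient, hence not their product. *)
have [z qz] : exists2 z, q.@[z] = 0 & (mleadc f1 * mleadc g1).@[z] != 0.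
  by apply: hypersurface_nullstellensatz => // /qP [].
rewrite mevalM mulf_eq0 => /norP[f1z g1z].
have [_ _ pP] := irreducible_prime_mpoly (pI z).
have mlead_p : mlead (map_mpoly (meval z) p) = mlead p.
  by apply: mlead_map_mpoly; rewrite /= pc mevalC.
(* Specialization at [z] preserves both leading monomials, so divisibility would make that of [p]
   divide that of [h]. *)
have not_dvd h : (mleadc h).@[z] != 0 -> ~~ (mlead p <= mlead h)%MM ->
    ~ dvd_elt (map_mpoly (meval z) p) (map_mpoly (meval z) h).
  move=> hz hp [w hE]; case/negP: hp.
  rewrite -mlead_p -(mlead_map_mpoly (f := meval z) hz) hE.
  have : map_mpoly (meval z) p * w != 0.
    rewrite -hE; apply: contraNneq hz => h0.
    by rewrite -(mcoeff_map_mpoly (meval z)) h0 mcoeff0.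
  by rewrite mulf_eq0 => /norP[pz0 w0]; rewrite mleadM // lem_addr.
have := map_meval_ideal2 qz f1g1; rewrite rmorphM => /pP [].
  exact: not_dvd.
exact: not_dvd.
Qed.

End PrimeIdeal2.

Lemma in_ideal_gen2 (R : comNzRingType) (a b x : R) :
  reflect (exists u v, x = u * a + v * b) (x \in ideal_gen [:: a; b]).
Proof.
apply: (iffP (asboolP _)) => [[c ->]|[u [v ->]]].
  by exists (c ord0), (c (lift ord0 ord0)); rewrite big_ord_recl big_ord1.
exists (fun i : 'I_2 => if val i is 0 then u else v).
by rewrite big_ord_recl big_ord1.
Qed.

Theorem lemma1p11 (K : closedFieldType) (charK0 : [pchar K]%R =i pred0)
    (s n : nat) (P Q : {mpoly K[s + n]})
    (homP : P \is homog mdeg) (homQ : Q \is homog mdeg)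
    (irrP : irreducible_elt P) (irrQ : irreducible_elt Q)
    (Qx : in_x_subring Q)
    (irrPx : irreducible_elt (to_xquot P)) :
  is_prime_ideal (ideal_gen [:: P; Q]).
Proof.
have [d dP] := homogP _ _ homP; have [q QE] := Qx.
have curryQ : curry_mpoly Q = q%:MP by rewrite QE curry_comp_lshift.
(* Setting y = 0 retracts S onto K[x], so irreducibility of [Q] in S descends to [q]. *)
have qI : irreducible_elt q.
  apply: (@irreducible_retract _ _ (comp_mpoly (xvars K s n))
    (meval (fun=> 0) \o @curry_mpoly K s n)); last by rewrite /= -QE.
  by move=> r; rewrite /= curry_comp_lshift mevalC.
have pC : exists2 c : K, c != 0 & mleadc (curry_mpoly P) = c%:MP.
  apply: (mleadc_curry_dhomog dP).
  by have [/eqP] := irreducible_eval0 irrPx.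
have pI z : irreducible_elt (map_mpoly (meval z) (curry_mpoly P)).
  by have := irreducible_eval_x z dP irrPx.
have toJ x : x \in ideal_gen [:: P; Q] <-> in_ideal2 (curry_mpoly P) q (curry_mpoly x).
  by split=> [/in_ideal_gen2/(in_ideal2_curry _ _ curryQ)|] //;
    move/(in_ideal2_curry _ _ curryQ)/in_ideal_gen2.
split.
  apply: ideal_gen_closed; apply/negP => /toJ; rewrite rmorph1.
  exact: ideal2_proper.
by move=> x y /toJ; rewrite rmorphM => /(ideal2_prime pC pI qI) [] /toJ ->; rewrite ?orbT.
Qed.
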